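(* Let $\mathcal{A}$ be a cluster algebra of rank $n$ (trivial coefficients) with indecomposable exchange matrices, with a fixed cluster pattern $\{\Sigma_t=(\mathbf{x}_t,B_t)\}_{t\in\mathbb{T}_n}$ and root vertex $t_0\in\mathbb{T}_n$. Let $r$ be a positive integer and let $t_{\diamond_1},\dots,t_{\diamond_r}\in\mathbb{T}_n$ be marked vertices such that, writing $t_{\diamond_0}:=t_0$: (i) $B_{t_{\diamond_i}}\not\sim\pm B_{t_{\diamond_j}}$ for all $0\le i\neq j\le r$; (ii) $\mathbf{w}_{t_{\diamond_i}}(t_0,t_{\diamond_i})=\mathbf{w}_{t_0}(t_0,t_{\diamond_i})=1$ for all $0\le i\le r$; (iii) $\mathbf{w}_{t_{\diamond_i}}(t_0,t_{\diamond_j})=0$ for all $1\le i<j\le r$. Then the cluster automorphism group $\operatorname{Aut}(\mathcal{A})$ is generated by the set $$G_0(t_0)\ \cup\bigcup_{(i_1,\dots,i_r)\in\{0,1,2\}^r}H_1(i_1,\dots,i_r)(t_0).$$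
   Context: **Seeds and mutation.** A square integer matrix $B$ is skew-symmetrizable if $DB$ is skew-symmetric for some diagonal matrix $D$ with positive integer diagonal entries. Let $\mathcal{F}$ be a purely transcendental extension field of $\mathbb{Q}$ of transcendence degree $n$. A labeled seed is a pair $(\mathbf{x},B)$ with $\mathbf{x}=(x_1,\dots,x_n)$ a transcendence basis generating $\mathcal{F}$ over $\mathbb{Q}$ (the cluster) and $B=(b_{ij})$ an $n\times n$ skew-symmetrizable integer matrix (the exchange matrix). The mutation $\mu_k(\mathbf{x},B)=(\mathbf{x}',B')$ is given by $x_i'=x_i$ for $i\ne k$, $x_kx_k'=\prod_{b_{ik}>0}x_i^{b_{ik}}+\prod_{b_{ik}<0}x_i^{-b_{ik}}$, and $b'_{ij}=-b_{ij}$ if $i=k$ or $j=k$, $b'_{ij}=b_{ij}+\frac12(|b_{ik}|b_{kj}+b_{ik}|b_{kj}|)$ otherwise. $B$ is indecomposable if the graph on $\{1,\dots,n\}$ with an edge between $i$ and $j$ whenever $b_{ij}\neq 0$ is connected. **Cluster pattern and cluster algebra.** $\mathbb{T}_n$ is the $n$-regular tree with edges labeled by $1,\dots,n$ so that the $n$ edges at each vertex carry distinct labels. A cluster pattern is a family of labeled seeds $\Sigma_t=(\mathbf{x}_t,B_t)$, $t\in\mathbb{T}_n$, with $\Sigma_{t'}=\mu_k(\Sigma_t)$ whenever $t,t'$ are joined by an edge labeled $k$. $\mathcal{A}$ is the subalgebra of $\mathcal{F}$ generated by all cluster variables (entries of all $\mathbf{x}_t$). **Permutations.** For $\sigma\in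 S_n$, $\sigma(\mathbf{x},B)=(\sigma\mathbf{x},\sigma(B))$, where $(\sigma\mathbf{x})_i=x_{\sigma^{-1}(i)}$ and $\sigma(B)_{ij}=b_{\sigma^{-1}(i)\sigma^{-1}(j)}$. Write $B\sim B'$ if $B'=\sigma(B)$ for some $\sigma\in S_n$, and $B\sim\pm B'$ if $B\sim B'$ or $B\sim -B'$. **Cluster automorphisms.** A cluster automorphism of $\mathcal{A}=\mathcal{A}(\mathbf{x},B)$ is a $\mathbb{Z}$-algebra automorphism $f:\mathcal{A}\to\mathcal{A}$ for which there are a seed $(\mathbf{x}',B')$ of $\mathcal{A}$ and $\sigma\in S_n$ with $\sigma f(\mathbf{x})=\mathbf{x}'$ and $\sigma(f(\mu_k(\mathbf{x})))=\mu_{\sigma(k)}(\mathbf{x}')$ for $k=1,\dots,n$. They form a group $\operatorname{Aut}(\mathcal{A})$ under composition. For $t,t'\in\mathbb{T}_n$, $\sigma\in S_n$, $\varepsilon\in\{\pm\}$ with $\sigma(B_t)=\varepsilon B_{t'}$, the notation $(\Sigma_t,\Sigma_{t'},\sigma,\varepsilon)$ denotes the unique cluster automorphism $f$ with $\sigma f(\mathbf{x}_t)=\mathbf{x}_{t'}$; every cluster automorphism is of this form. **Paths and weights.** $p(t,t')$ is the unique (reduced) path in $\mathbb{T}_n$ from $t$ to $t'$. For $s\in\mathbb{T}_n$, $\mathbf{w}_s(t,t')$ is the number of vertices $t''$ on $p(t,t')$ (endpoints included) with $B_{t''}\sim\pm B_s$. **The sets.** $\mathcal{P}_1(t_0)$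 is the set of paths $p(t_0,t)$ with $\mathbf{w}_{t_0}(t_0,t)=2$ and $B_t\sim\pm B_{t_0}$. For each such path fix once and for all $\sigma_t\in S_n$, $\varepsilon_t\in\{\pm\}$ with $\sigma_t(B_{t_0})=\varepsilon_tB_t$ and put $f_{p(t_0,t)}:=(\Sigma_{t_0},\Sigma_t,\sigma_t,\varepsilon_t)$. For nonnegative integers $i_1,\dots,i_r$: - $\mathcal{P}_1(i_1,\dots,i_r)(t_0):=\{p(t_0,t)\in\mathcal{P}_1(t_0)\mid \mathbf{w}_{t_{\diamond_k}}(t_0,t)=i_k\text{ for }1\le k\le r\}$; - $H_1(i_1,\dots,i_r)(t_0):=\{f_{p(t_0,t)}\mid p(t_0,t)\in\mathcal{P}_1(i_1,\dots,i_r)(t_0)\}$. $G_0(t_0)$ is the set of cluster automorphisms of the form $(\Sigma_{t_0},\Sigma_s,\sigma,\varepsilon)$ for some $s\in\mathbb{T}_n$ with $\mathbf{w}_{t_0}(t_0,s)=1$, $\sigma\in S_n$, $\varepsilon\in\{\pm\}$. *)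

(* Defs.v *)
From HB Require Import structures.
From mathcomp Require Import all_boot all_order all_algebra all_fingroup.
From mathcomp Require Import boolp classical_sets.
From mathcomp Require Import mpoly.

Set Implicit Arguments.
Unset Strict Implicit.
Unset Printing Implicit Defensive.

Import Order.TTheory GRing.Theory Num.Theory.

Local Open Scope ring_scope.

Section Seeds.
Variables (n : nat) (F : fieldType).

Definition skew_symmetrizable (B : 'M[int]_n) : Prop :=
  exists d : 'rV[int]_n,
    (forall i, 0 < d 0 i) /\ (diag_mx d *m B)^T = - (diag_mx d *m B).

Definition indecomposable (B : 'M[int]_n) : Prop :=
  forall i j : 'I_n, connect (fun k l => (B k l != 0) || (B l k != 0)) i j.

Definition mx_mutation (k : 'I_n) (B : 'M[int]_n) : 'M[int]_n :=
  \matrix_(i, j)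
    if (i == k) || (j == k) then - B i j
    else B i j + ((`|B i k| * B k j + B i k * `|B k j|) %/ 2)%Z.

Definition mx_relabel (s : 'S_n) (B : 'M[int]_n) : 'M[int]_n :=
  \matrix_(i, j) B ((s^-1)%g i) ((s^-1)%g j).

(* A sign is a boolean [e], standing for [(-1) ^+ e]. *)
Definition mx_sim_pm (B B' : 'M[int]_n) : bool :=
  [exists s : 'S_n, [exists e : bool, mx_relabel s B == (-1) ^+ e *: B']].

(* The value p(x_1, ..., x_n) of a polynomial with rational coefficients. *)
Definition peval (x : {ffun 'I_n -> F}) (p : {mpoly rat[n]}) : F :=
  mmap (fun q : rat => ratr q) x p.

(* x is a transcendence basis of F over Q such that moreover F = Q(x). *)
Definition free_generators (x : {ffun 'I_n -> F}) : Prop :=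
  (forall p : {mpoly rat[n]}, peval x p = 0 -> p = 0) /\
  (forall y : F, exists p q : {mpoly rat[n]}, peval x q != 0 /\ y = peval x p / peval x q).

Definition purely_transcendental : Prop :=
  [pchar F] =i pred0 /\ exists x, free_generators x.

Definition seed_data : Type := {ffun 'I_n -> F} * 'M[int]_n.
Definition cluster (S : seed_data) : {ffun 'I_n -> F} := S.1.
Definition exchange_mx (S : seed_data) : 'M[int]_n := S.2.

Definition labeled_seed (S : seed_data) : Prop :=
  free_generators (cluster S) /\ skew_symmetrizable (exchange_mx S).

Definition seed_mutation (k : 'I_n) (S : seed_data) : seed_data :=
  let: (x, B) := S in
  ([ffun i => if i == k then
       (\prod_(j | 0 < B j k) x j ^+ `|B j k|%N
        + \prod_(j | B j k < 0) x j ^+ `|B j k|%N) / x k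
     else x i],
   mx_mutation k B).

End Seeds.

Definition simple_path (n : nat) (V : eqType) (nbr : 'I_n -> V -> V)
    (t t' : V) (p : seq V) : bool :=
  [&& path (fun u v => [exists k, nbr k u == v]) t p,
      last t p == t' & uniq (t :: p)].

(* The n-regular tree T_n.  [nbr k t] is the other end of the edge labeled k  *)
(* at t.  The simple paths do not see loops and multiple edges, hence the     *)
(* axioms [nbr_irrefl] and [nbr_inj].                                         *)
Record labeled_tree (n : nat) := LabeledTree {
  vertex :> choiceType;
  nbr : 'I_n -> vertex -> vertex;
  nbrK : forall k, involutive (nbr k);
  nbr_irrefl : forall k t, nbr k t != t;
  nbr_inj : forall t, injective (fun k => nbr k t);
  tree_path_ex : forall t t', exists p, simple_path nbr t t' p;
  tree_path_uniq : forall t t' p q,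
    simple_path nbr t t' p -> simple_path nbr t t' q -> p = q
}.

(* The list of all vertices of p(t, t'), both endpoints included. *)
Definition tree_path (n : nat) (T : labeled_tree n) (t t' : T) : seq T :=
  t :: xchoose (tree_path_ex t t').

Record cluster_pattern (n : nat) (F : fieldType) (T : labeled_tree n) :=
  ClusterPattern {
    seed_at :> T -> seed_data n F;
    seed_atP : forall t, labeled_seed (seed_at t);
    seed_at_nbr : forall k t, seed_at (nbr k t) = seed_mutation k (seed_at t)
  }.

Section ClusterAlgebra.
Variables (n : nat) (F : fieldType) (T : labeled_tree n).
Variable Sigma : cluster_pattern F T.

(* Membership in the subring of F generated by all the cluster variables. *)
Definition in_cluster_algebra : {pred F} := fun y : F =>
  `[< forall P : {pred F}, subring_closed P ->
        (forall t i, cluster (Sigma t) i \in P) -> y \in P >].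

Lemma in_cluster_algebra_subring : subring_closed in_cluster_algebra.
Proof.
split=> [|y z /asboolP Hy /asboolP Hz|y z /asboolP Hy /asboolP Hz];
  apply/asboolP => P clP HP; case: (clP) => P1 PB PM.
- exact: P1.
- by apply: PB; [apply: Hy|apply: Hz].
- by apply: PM; [apply: Hy|apply: Hz].
Qed.

HB.instance Definition _ :=
  GRing.isSubringClosed.Build F in_cluster_algebra in_cluster_algebra_subring.

Record cluster_algebra : Type := ClusterAlgebra {
  cluster_algebra_val :> F;
  cluster_algebra_valP : cluster_algebra_val \in in_cluster_algebra
}.

HB.instance Definition _ := [isSub for cluster_algebra_val].
HB.instance Definition _ := [Choice of cluster_algebra by <:].
HB.instance Definition _ := [SubChoice_isSubComNzRing of cluster_algebra by <:].

Lemma cluster_var_subproof t i : cluster (Sigma t) i \in in_cluster_algebra.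
Proof. by apply/asboolP => P _; apply. Qed.

Definition cluster_var (t : T) (i : 'I_n) : cluster_algebra :=
  ClusterAlgebra (cluster_var_subproof t i).

Local Open Scope classical_set_scope.

Definition ring_aut : set (cluster_algebra -> cluster_algebra) :=
  [set f | [/\ zmod_morphism f, monoid_morphism f & bijective f]].

(* sigma f(x_t) = x_t', as an equality of labeled clusters. *)
Definition maps_cluster (f : cluster_algebra -> cluster_algebra)
    (s : 'S_n) (t t' : T) : Prop :=
  forall i, f (cluster_var t ((s^-1)%g i)) = cluster_var t' i.

(* Cluster automorphisms of A(x_t0, B_t0).  By [seed_at_nbr], the cluster at  *)
(* [nbr k t] is mu_k(x_t), so the second condition on f is                    *)
(* sigma f(mu_k(x_t0)) = mu_sigma(k)(x_t').                                   *)
Definition cluster_aut (t0 : T) : set (cluster_algebra -> cluster_algebra) :=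
  [set f | ring_aut f /\ exists t' (s : 'S_n), maps_cluster f s t0 t' /\
     forall k, maps_cluster f s (nbr k t0) (nbr (s k) t')].

Definition is_subgroup (H : set (cluster_algebra -> cluster_algebra)) : Prop :=
  [/\ H `<=` ring_aut, H id,
      forall f g, H f -> H g -> H (f \o g)
    & forall f g, H f -> cancel f g -> cancel g f -> H g].

Definition generated_subgroup (X : set (cluster_algebra -> cluster_algebra)) :
    set (cluster_algebra -> cluster_algebra) :=
  smallest is_subgroup X.

Definition weight (s t t' : T) : nat :=
  count (fun u => mx_sim_pm (exchange_mx (Sigma u)) (exchange_mx (Sigma s)))
        (tree_path t t').

Definition matches (t t' : T) (s : 'S_n) (e : bool) : Prop :=
  mx_relabel s (exchange_mx (Sigma t)) = (-1) ^+ e *: exchange_mx (Sigma t').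

(* f is the cluster automorphism (Sigma_t, Sigma_t', s, e) of A(x_t0, B_t0). *)
Definition is_aut_of (t0 t t' : T) (s : 'S_n) (e : bool)
    (f : cluster_algebra -> cluster_algebra) : Prop :=
  [/\ matches t t' s e, cluster_aut t0 f & maps_cluster f s t t'].

(* Sets of paths starting at t0 are given as the sets of their endpoints. *)
Definition P1 (t0 : T) : set T :=
  [set t | weight t0 t0 t = 2%N /\
           mx_sim_pm (exchange_mx (Sigma t)) (exchange_mx (Sigma t0))].

Definition P1_marked (t0 : T) (r : nat) (mark : 'I_r -> T) (i : 'I_r -> nat) :
    set T :=
  [set t | P1 t0 t /\ forall k, weight (mark k) t0 t = i k].

Definition H1 (t0 : T) (sg : T -> 'S_n) (ep : T -> bool)
    (r : nat) (mark : 'I_r -> T) (i : 'I_r -> nat) :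
    set (cluster_algebra -> cluster_algebra) :=
  [set f | exists2 t, P1_marked t0 mark i t
                    & is_aut_of t0 t0 t (sg t) (ep t) f].

Definition G0 (t0 : T) : set (cluster_algebra -> cluster_algebra) :=
  [set f | exists u s e, weight t0 t0 u = 1%N /\ is_aut_of t0 t0 u s e f].

End ClusterAlgebra.

Arguments cluster_aut {n F T} Sigma t0 _.
Arguments G0 {n F T} Sigma t0 _.
Arguments H1 {n F T} Sigma t0 sg ep {r} mark i _.

(* The family t_0, t_1, ..., t_r obtained by prepending the root. *)
Definition with_root (V : Type) (t0 : V) (r : nat) (mark : 'I_r -> V)
    (i : 'I_r.+1) : V :=
  if unlift ord0 i is Some j then mark j else t0.

(* Main.v *)
(* By indecomposability a cluster automorphism f matches B_(t0) with           *)
(* +-B_t for a vertex t, and then induces an automorphism tau of the labeled   *)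
(* tree under which exchange matrices correspond up to a global sign and a     *)
(* permutation; in particular tau preserves weights.  If v ~ t0 and g sends    *)
(* t0 to v, then f = g o (g^-1 f), where g^-1 f sends t0 to the end of a copy  *)
(* of p(v, t).  Splitting at an interior vertex v of p(t0, t) reduces to       *)
(* w_(t0)(t0, t) <= 2.  If such a path meets the class of the marked vertex    *)
(* t_j at least three times, carry p(t_j, t0) to a middle occurrence u of that *)
(* class and split at the image v of t0: this strictly decreases the weight    *)
(* of t_j, and by (iii) does not increase the weights of t_1, ..., t_(j-1)     *)
(* above 2, so the marked vertices can be treated one after the other.         *)

From HB Require Import structures.
Require Import Defs.
From mathcomp Require Import all_boot all_order all_algebra all_fingroup.
From mathcomp Require Import boolp classical_sets.
From mathcomp Require Import mpoly zify.

Set Implicit Arguments.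
Unset Strict Implicit.
Unset Printing Implicit Defensive.

Import Order.TTheory GRing.Theory Num.Theory.

Local Open Scope ring_scope.

(** A cluster automorphism comes with an automorphism [tau] of the labeled tree along which exchange
    matrices agree up to relabeling and one sign ([cluster_autP]); the sign is global because the
    graph of the matrix is connected ([aut_match]). Conversely every match of B_t with B_u up to
    sign is realized by an automorphism ([aut_data_ex]). As [tau] preserves weights
    ([aut_data_weight]), generation becomes a question about vertices t ~ t0.

    Let H be a subgroup containing the generators. If some element of H sends t0 to v, an
    automorphism sending t0 to t factors through it, leaving a copy of p(v, t) ([reached_split]).
    Splitting at interior vertices v ~ t0 reduces to w_(t0) <= 2 ([reached_all]). The marks are then
    treated in order ([reached_two_marked]): if the class of t_j occurs three times, move p(t_j, t0)
    so that t_j lands on a middle occurrence u, and split at the image v of t0. Subadditivity of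
    weights makes the weight of t_j drop on both pieces; (ii) keeps w_(t0) at most 2 and (iii)
    protects the earlier marks. Once all marked weights are at most 2, H1 provides one automorphism
    with the right endpoint, and G0 the stabilizer of t0. *)

(** * Paths and label-permuting automorphisms of the tree *)

Section Tree.
Variables (n : nat) (T : labeled_tree n).
Implicit Types (t u v : T) (k : 'I_n) (s : 'S_n).

Definition tree_adj u v := [exists k, nbr k u == v].

Lemma tree_adj_nbr k u : tree_adj u (nbr k u).
Proof. by apply/existsP; exists k. Qed.

Lemma tree_adj_sym u v : tree_adj u v = tree_adj v u.
Proof.
by apply/existsP/existsP => -[k /eqP <-]; exists k; rewrite nbrK.
Qed.

Lemma tree_pathE t u p : simple_path (@nbr n T) t u p -> tree_path t u = t :: p.
Proof. by move=> tup; congr cons; exact: tree_path_uniq (xchooseP _) tup. Qed.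

Lemma tree_pathP t u : exists2 p,
  tree_path t u = t :: p & [/\ path tree_adj t p, last t p = u & uniq (t :: p)].
Proof.
have /and3P[tp /eqP tu up] := xchooseP (tree_path_ex t u).
by exists (xchoose (tree_path_ex t u)).
Qed.

Lemma tree_pathI t u p :
  path tree_adj t p -> last t p = u -> uniq (t :: p) -> tree_path t u = t :: p.
Proof. by move=> tp /eqP tu up; apply: tree_pathE; apply/and3P. Qed.

Lemma tree_path_refl t : tree_path t t = [:: t].
Proof. exact: tree_pathI. Qed.

Lemma tree_path_sym t u : tree_path u t = rev (tree_path t u).
Proof.
have [p -> [tp tu up]] := tree_pathP t u.
rewrite lastI rev_rcons tu; apply: tree_pathI.
- rewrite -tu (@eq_path _ _ (fun x y => tree_adj y x)) ?rev_path // => x y.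
  exact: tree_adj_sym.
- by case: p {tp up} tu => [|v p] tu //=; rewrite rev_cons last_rcons.
- by rewrite -tu -rev_rcons -lastI rev_uniq.
Qed.

Lemma tree_path_split t u v p1 p2 : tree_path t u = p1 ++ v :: p2 ->
  tree_path t v = rcons p1 v /\ tree_path v u = v :: p2.
Proof.
have [p -> [tp tu up]] := tree_pathP t u.
case: p1 => [|w p1] [tw pE]; move: tp tu up; rewrite pE {p pE}; subst.
  by move=> tp tu up; rewrite tree_path_refl (tree_pathI tp tu up).
rewrite cat_path last_cat [path _ _ (v :: _)]/= => /and3P[wp1 adj_v vp2] vu.
rewrite -[w :: p1 ++ _]/((w :: p1) ++ _) cat_uniq => /and3P[up1 disj up2].
split; last exact: tree_pathI.
rewrite rcons_cons; apply: tree_pathI; rewrite ?last_rcons ?rcons_path ?wp1 //.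
rewrite -rcons_cons rcons_uniq up1 andbT.
by apply: contra disj => vp1; apply/hasP; exists v => //; rewrite inE eqxx.
Qed.

Lemma tree_path_cat t u v : v \in tree_path t u ->
  tree_path t u = tree_path t v ++ behead (tree_path v u).
Proof.
case/path.splitPr E: _ / => [p1 p2]; have [-> ->] := tree_path_split E.
by rewrite cat_rcons.
Qed.

Lemma tree_path_nbr k t u :
     tree_path t (nbr k u) = rcons (tree_path t u) (nbr k u)
  \/ tree_path t u = rcons (tree_path t (nbr k u)) u.
Proof.
have [inp|notp] := boolP (nbr k u \in tree_path t u).
  right; rewrite (tree_path_cat inp) (@tree_pathI (nbr k u) u [:: u]) ?cats1 //=.
    by rewrite tree_adj_sym tree_adj_nbr.
  by rewrite inE nbr_irrefl.
left; move: notp; have [p -> [tp tu up]] := tree_pathP t u => notp.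
rewrite rcons_cons; apply: tree_pathI; rewrite ?last_rcons //.
  by rewrite rcons_path tp tu tree_adj_nbr.
by rewrite -rcons_cons rcons_uniq notp.
Qed.

Lemma tree_ind (P : T -> Prop) t :
  P t -> (forall k u, P u -> P (nbr k u)) -> forall u, P u.
Proof.
move=> Pt Pnbr u; have [p _ [tp <- _]] := tree_pathP t u.
elim: p t Pt tp => //= v p IHp t Pt /andP[/existsP[k /eqP <-]].
exact/IHp/Pnbr.
Qed.

(** The reduced path is a shortening of the walk through u. That walk passes the joint u once while
    the right side counts it twice; this saving makes the later descent on marked weights strict. *)
Lemma tree_path_subadd (a : pred T) t u v :
  (count a (tree_path t v) + a u
     <= count a (tree_path t u) + count a (tree_path u v))%N.
Proof.
have [p -> [tp tu up]] := tree_pathP t u.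
have [q -> [uq qv uuq]] := tree_pathP u v.
have pq : path tree_adj t (p ++ q) by rewrite cat_path tp tu.
have lpq : last t (p ++ q) = v by rewrite last_cat tu.
case: (shortenP pq) lpq => r tr ur sub_r rv; rewrite (tree_pathI tr rv ur).
rewrite [count a (u :: q)]/= addnA [X in (_ <= X)%N]addnAC leq_add2r -count_cat.
rewrite -!size_filter uniq_leq_size ?filter_uniq // => x.
rewrite !mem_filter => /andP[-> ]; rewrite cat_cons !inE => /orP[->//|xr].
by rewrite sub_r ?orbT.
Qed.

Lemma tree_path_count_cat (a : pred T) t u v : u \in tree_path t v ->
  (count a (tree_path t v) + a u
     = count a (tree_path t u) + count a (tree_path u v))%N.
Proof.
move/tree_path_cat=> ->; rewrite count_cat.
by have [q -> _] := tree_pathP u v; rewrite /= -addnA (addnC _ (a u : nat)).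
Qed.

Definition tree_equivariant s (tau : T -> T) :=
  forall k u, tau (nbr k u) = nbr (s k) (tau u).

Lemma tree_equivariant_ext s tau tau' t :
  tree_equivariant s tau -> tree_equivariant s tau' -> tau t = tau' t ->
  tau =1 tau'.
Proof.
by move=> etau etau' eqt; apply: (tree_ind eqt) => k u equ; rewrite etau etau' equ.
Qed.

(** Replay from t' the labels of the path from t, permuted by [s]; uniqueness of paths makes this
    consistent. *)
Lemma tree_equivariant_ex s t t' :
  exists2 tau, tree_equivariant s tau & tau t = t'.
Proof.
(* The default [x] is never met: consecutive vertices of a path are adjacent. *)
pose step (u v x : T) := if [pick k | nbr k u == v] is Some k then nbr (s k) x else x.
have stepE k u x : step u (nbr k u) x = nbr (s k) x.
  rewrite /step; case: pickP => [l /eqP /(@nbr_inj _ _ u) -> //|/(_ k)].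
  by rewrite eqxx.
pose tr := fix tr (p : seq T) (u x : T) :=
  if p is v :: p' then tr p' v (step u v x) else x.
have tr_rcons p u v x : tr (rcons p v) u x = step (last u p) v (tr p u x).
  by elim: p u x => //= w p IHp u x; rewrite IHp.
exists (fun u => tr (behead (tree_path t u)) t t'); last first.
  by rewrite tree_path_refl.
move=> k u; have [p tpu [tp tu up]] := tree_pathP t u.
have [q tpv [tq tv uq]] := tree_pathP t (nbr k u).
have [] := tree_path_nbr k t u; rewrite tpu tpv /= => -[->] /=.
  by rewrite tr_rcons tu stepE.
by rewrite tr_rcons tv -{2}(nbrK k u) stepE nbrK.
Qed.

Lemma tree_equivariant_inv s tau : tree_equivariant s tau ->
  exists tau', [/\ tree_equivariant (s^-1)%g tau', cancel tau tau' & cancel tau' tau].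
Proof.
move=> etau.
have eid : tree_equivariant 1%g id by move=> k u; rewrite perm1.
have [|t] := pselect (exists t : T, True); last first.
  by exists id; split=> [k u|u|u]; case: t; exists u.
case=> t _; have [tau' etau' ett] := tree_equivariant_ex (s^-1)%g (tau t) t.
exists tau'; split=> // u; last first.
  apply: (@tree_equivariant_ext 1%g (tau \o tau') id (tau t)) => //= [k v|].
    by rewrite /= etau' etau permKV perm1.
  by rewrite ett.
apply: (@tree_equivariant_ext 1%g (tau' \o tau) id t) => //= k v.
by rewrite /= etau etau' permK perm1.
Qed.

Lemma tree_equivariant_path s tau t u : tree_equivariant s tau ->
  tree_path (tau t) (tau u) = map tau (tree_path t u).
Proof.
move=> etau; have [tau' [_ tauK _]] := tree_equivariant_inv etau.
have [p -> [tp tu up]] := tree_pathP t u.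
rewrite [RHS]/=; apply: tree_pathI; last 1 first.
- by rewrite -map_cons map_inj_uniq //; apply: can_inj tauK.
- rewrite path_map; apply: sub_path tp => v w /existsP[k /eqP <-] /=.
  by rewrite etau tree_adj_nbr.
- by rewrite last_map tu.
Qed.

End Tree.

(** * Matching of exchange matrices up to relabeling and sign *)

Section ExchangeMatrix.
Variable n : nat.
Implicit Types (B C D : 'M[int]_n) (s : 'S_n) (e : bool) (k : 'I_n).

Definition mx_match s e B C := forall i j, C (s i) (s j) = (-1) ^+ e * B i j.

Lemma mx_matchP s e B C : mx_relabel s B = (-1) ^+ e *: C <-> mx_match s e B C.
Proof.
split=> [/matrixP eqBC i j|BC]; last first.
  by apply/matrixP => i j; rewrite !mxE -[i in RHS](permKV s) -[j in RHS](permKV s) BC signrMK.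
by have := eqBC (s i) (s j); rewrite !mxE !permK => ->; rewrite signrMK.
Qed.

Lemma mx_match_id B : mx_match 1%g false B B.
Proof. by move=> i j; rewrite !perm1 mul1r. Qed.

Lemma mx_match_comp s s' e e' B C D :
  mx_match s e B C -> mx_match s' e' C D -> mx_match (s * s')%g (e' (+) e) B D.
Proof. by move=> BC CD i j; rewrite !permM CD BC signr_addb mulrA. Qed.

Lemma mx_match_inv s e B C : mx_match s e B C -> mx_match s^-1%g e C B.
Proof. by move=> BC i j; rewrite -{2}(permKV s i) -{2}(permKV s j) BC signrMK. Qed.

Lemma mx_sim_pmP B C : reflect (exists s e, mx_match s e B C) (mx_sim_pm B C).
Proof.
apply: (iffP existsP) => -[s].
  by move=> /existsP[e /eqP/mx_matchP BC]; exists s, e.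
by move=> [e /mx_matchP BC]; exists s; apply/existsP; exists e; apply/eqP.
Qed.

Lemma mx_sim_pm_refl B : mx_sim_pm B B.
Proof. by apply/mx_sim_pmP; exists 1%g, false; apply: mx_match_id. Qed.

Lemma mx_sim_pm_sym B C : mx_sim_pm B C = mx_sim_pm C B.
Proof.
by apply/mx_sim_pmP/mx_sim_pmP => -[s [e /mx_match_inv]]; exists s^-1%g, e.
Qed.

Lemma mx_sim_pm_trans C B D : mx_sim_pm B C -> mx_sim_pm C D -> mx_sim_pm B D.
Proof.
move=> /mx_sim_pmP[s [e BC]] /mx_sim_pmP[s' [e' CD]].
by apply/mx_sim_pmP; exists (s * s')%g, (e' (+) e); exact: mx_match_comp CD.
Qed.

Lemma mx_sim_pm_left B C D : mx_sim_pm B C -> mx_sim_pm B D = mx_sim_pm C D.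
Proof.
move=> BC; apply/idP/idP; last exact: mx_sim_pm_trans.
by apply: mx_sim_pm_trans; rewrite mx_sim_pm_sym.
Qed.

(** The halving in a mutation is exact, hence commutes with a change of sign, unlike rounded
    division. *)
Lemma mutation_term_even (x y : int) : (2 %| `|x| * y + x * `|y|)%Z.
Proof.
case: (ger0P x) => _; case: (ger0P y) => _.
- by rewrite -mulr2n -(mulr_natr (x * y)) dvdz_mull.
- by rewrite mulrN subrr dvdz0.
- by rewrite mulNr addNr dvdz0.
- by rewrite mulNr mulrN -opprD -mulr2n -(mulr_natr (x * y)) -mulNr dvdz_mull.
Qed.

Lemma mx_match_mutation s e B C k :
  mx_match s e B C -> mx_match s e (mx_mutation k B) (mx_mutation (s k) C).
Proof.
move=> BC i j; rewrite !mxE !(inj_eq perm_inj) !BC.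
case: ifP => _; first by rewrite mulrN.
rewrite mulrDr !normrMsign (mulrCA `|_|) -mulrA -[X in (X %/ _)%Z]mulrDr.
have /dvdzP[z ->] := mutation_term_even (B i k) (B k j).
by rewrite mulrA !mulzK.
Qed.

End ExchangeMatrix.

(** * Evaluation of rational polynomials and substitution morphisms *)

Section RationalScalars.
Variables (F : fieldType) (F0 : [pchar F] =i pred0).

Lemma pchar0_intr_eq0 (z : int) : (z%:~R == 0 :> F) = (z == 0).
Proof.
by case: z => m; rewrite ?NegzE ?mulrNz ?oppr_eq0; rewrite -pmulrn (pcharf0P _).1.
Qed.

(** Characteristic zero keeps denominators nonzero in [F], so a fraction need not be reduced; this
    makes [ratr], and then [peval], ring morphisms. *)
Lemma ratr_frac (a b : int) : b != 0 -> ratr (a%:~R / b%:~R) = a%:~R / b%:~R :> F.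
Proof.
move=> b0; set q := _ / _.
have dq : denq q != 0 by exact: denq_neq0.
apply/eqP; rewrite eqr_div ?pchar0_intr_eq0 // -!rmorphM.
apply/eqP; congr (_%:~R); apply/(@intr_inj rat); rewrite !rmorphM /=.
apply/eqP; rewrite -eqr_div ?intr_eq0 //.
by rewrite divq_num_den.
Qed.

Lemma pchar0_ratr_zmod_morphism : zmod_morphism (@ratr F).
Proof.
move=> x y; rewrite -{1}(divq_num_den x) -{1}(divq_num_den y).
have [dx dy] : denq x != 0 /\ denq y != 0 by rewrite !denq_neq0.
rewrite -mulNr addf_div ?intr_eq0 // -!rmorphN -!rmorphM -rmorphD.
rewrite ratr_frac ?mulf_neq0 // intrD !intrM mulrNz.
by rewrite -addf_div ?pchar0_intr_eq0 // mulNr.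
Qed.

Lemma pchar0_ratr_monoid_morphism : monoid_morphism (@ratr F).
Proof.
split=> [|x y]; first by rewrite -[1]/(1%:~R) ratr_int.
rewrite -{1}(divq_num_den x) -{1}(divq_num_den y) mulf_div -!rmorphM.
by rewrite ratr_frac ?mulf_neq0 ?denq_neq0 // !rmorphM -mulf_div.
Qed.

Definition pchar0_ratr : {rmorphism rat -> F} :=
  HB.pack (@ratr F) (GRing.isZmodMorphism.Build _ _ _ pchar0_ratr_zmod_morphism)
    (GRing.isMonoidMorphism.Build _ _ _ pchar0_ratr_monoid_morphism).

Variable n : nat.
Implicit Types (x y : {ffun 'I_n -> F}) (p q : {mpoly rat[n]}).

Definition algebraically_free x := forall p, peval x p = 0 -> p = 0.

Definition peval_rmorph x : {rmorphism {mpoly rat[n]} -> F} := mmap pchar0_ratr x.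

Lemma peval_rmorphE x p : peval x p = peval_rmorph x p. Proof. by []. Qed.

Lemma pevalX x m : peval x 'X_[m] = \prod_i x i ^+ m i.
Proof. exact: (mmapX x pchar0_ratr). Qed.

Lemma pevalXU x i : peval x 'X_i = x i.
Proof. by rewrite -[LHS]/(mmap pchar0_ratr x _) mmapX mmap1U. Qed.

Lemma peval_perm x (s : 'S_n) p : peval [ffun i => x (s i)] p = peval x (msym s p).
Proof.
rewrite (peval_rmorphE x) /msym [in RHS]/mmap rmorph_sum; apply: eq_bigr => m _.
rewrite rmorphM /=; congr (_ * _); first exact/esym/(mmapC x pchar0_ratr).
rewrite -[RHS]/(peval_rmorph x _) rmorph_prod; apply: eq_bigr => i _.
by rewrite rmorphXn /= ffunE -[X in _ = X ^+ _]/(peval x 'X_(s i)) pevalXU.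
Qed.

Lemma algebraically_free_perm x (s : 'S_n) :
  algebraically_free x -> algebraically_free [ffun i => x (s i)].
Proof.
move=> xfree p; rewrite peval_perm => /xfree sp0.
by apply: (inj_msym s); rewrite sp0 msym0.
Qed.

Lemma algebraically_free_neq0 x i : algebraically_free x -> x i != 0.
Proof.
move=> xfree; rewrite -pevalXU; apply/eqP => /xfree /(congr1 (mcoeff U_(i)%MM)) /eqP.
by rewrite mcoeffX eqxx mcoeff0 oner_eq0.
Qed.

(** Write each z as a chosen fraction in x and substitute y. Freeness of x makes the value
    independent of the fraction; freeness of y keeps the denominator nonzero. *)
Lemma free_generators_hom x y : free_generators x -> algebraically_free y ->
  exists phi : {rmorphism F -> F}, forall i, phi (x i) = y i.
Proof.
move=> [xfree xgen] yfree.
pose num z := projT1 (cid (xgen z)); pose den z := projT1 (cid (projT2 (cid (xgen z)))).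
have denP z : peval x (den z) != 0 by have [] := projT2 (cid (projT2 (cid (xgen z)))).
have fracP z : z = peval x (num z) / peval x (den z).
  by have [] := projT2 (cid (projT2 (cid (xgen z)))).
have transfer p : peval x p != 0 -> peval y p != 0.
  by apply: contraNneq => /yfree ->; rewrite peval_rmorphE rmorph0.
pose phi z := peval y (num z) / peval y (den z).
have phiE p q : peval x q != 0 -> phi (peval x p / peval x q) = peval y p / peval y q.
  move=> q0; set z := _ / _; apply/eqP; rewrite eqr_div ?transfer ?denP //.
  have /eqP : z = peval x (num z) / peval x (den z) by [].
  rewrite eqr_div ?denP // !peval_rmorphE -!rmorphM -subr_eq0 -rmorphB.
  by move/eqP/xfree/eqP; rewrite subr_eq0 => /eqP ->.
have phiZ : zmod_morphism phi.
  move=> u v; rewrite [in LHS](fracP u) [in LHS](fracP v) -mulNr addf_div //.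
  rewrite !peval_rmorphE -rmorphN -!rmorphM -rmorphD -!peval_rmorphE.
  rewrite phiE; last first.
    by rewrite peval_rmorphE rmorphM; apply: mulf_neq0 (denP _) (denP _).
  by rewrite !peval_rmorphE rmorphD !rmorphM rmorphN -addf_div ?mulNr //; apply: transfer (denP _).
have phiM : monoid_morphism phi.
  split=> [|z w].
    have := @phiE 1 1; rewrite !peval_rmorphE !rmorph1 divr1; apply.
    exact: oner_neq0.
  rewrite [in LHS](fracP z) [in LHS](fracP w) mulf_div.
  rewrite !peval_rmorphE -!rmorphM -!peval_rmorphE.
  rewrite phiE; last first.
    by rewrite peval_rmorphE rmorphM; apply: mulf_neq0 (denP _) (denP _).
  by rewrite !peval_rmorphE !rmorphM -mulf_div.
exists (HB.pack_for {rmorphism F -> F} phi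
  (GRing.isZmodMorphism.Build _ _ _ phiZ) (GRing.isMonoidMorphism.Build _ _ _ phiM)).
move=> i /=; have := @phiE 'X_i 1; rewrite !pevalXU !peval_rmorphE !rmorph1 !divr1.
by apply; exact: oner_neq0.
Qed.

End RationalScalars.

(** * Exchange polynomials and the sign of a column *)

(** Multiplied by d_i d_j > 0, the product becomes -(d_i b_ij)^2. *)
Lemma skew_symmetrizable_mul_lt0 n (B : 'M[int]_n) i j :
  skew_symmetrizable B -> B i j != 0 -> B i j * B j i < 0.
Proof.
move=> [d [d0 /matrixP/(_ j i)]]; rewrite !mul_diag_mx !mxE => dB b0.
have [di dj] : 0 < d 0 i /\ 0 < d 0 j by split.
rewrite -(pmulr_rlt0 _ di) -(pmulr_rlt0 _ dj).
have -> : d 0 j * (d 0 i * (B i j * B j i)) = - (d 0 i * B i j) ^+ 2.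
  by rewrite [d 0 i * (_ * _)]mulrA dB mulNr mulrN sqrrN expr2 mulrCA.
rewrite oppr_lt0 exprn_even_gt0 //; apply: mulf_neq0 b0.
exact: lt0r_neq0.
Qed.

(** The right side of the exchange relation for a column [b], over any ring so that it can be moved
    between the cluster algebra and [F]. *)
Definition exchange_poly n (R : comNzRingType) (y : 'I_n -> R) (b : 'I_n -> int) : R :=
  \prod_(j | 0 < b j) y j ^+ `|b j|%N + \prod_(j | b j < 0) y j ^+ `|b j|%N.

Section ExchangePolynomial.
Variable n : nat.
Implicit Types (R : comNzRingType) (b c : 'I_n -> int).

Lemma rmorph_exchange_poly R R' (g : {rmorphism R -> R'}) y b :
  g (exchange_poly y b) = exchange_poly (g \o y) b.
Proof.
by rewrite rmorphD !rmorph_prod; congr (_ + _); apply: eq_bigr => j _; rewrite rmorphXn.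
Qed.

(** A change of sign swaps the two monomials. *)
Lemma exchange_poly_sign R (y : 'I_n -> R) b c (e : bool) :
  (forall j, c j = (-1) ^+ e * b j) -> exchange_poly y c = exchange_poly y b.
Proof.
move=> cb; rewrite /exchange_poly; case: e cb => cb; last first.
  by congr (_ + _); apply: eq_big => j; rewrite cb mul1r.
rewrite [LHS]addrC; congr (_ + _); apply: eq_big => j; rewrite cb mulN1r ?abszN //.
  by rewrite oppr_lt0.
by rewrite oppr_gt0.
Qed.

Lemma exchange_poly_perm R (y : 'I_n -> R) b (s : 'S_n) :
  exchange_poly (y \o s) (b \o s) = exchange_poly y b.
Proof. by rewrite /exchange_poly; congr (_ + _); rewrite [RHS](reindex_inj (@perm_inj _ s)). Qed.

Definition pos_part b := [multinom (if (0 < b j)%R then `|b j|%N else 0%N) | j < n].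
Definition neg_part b := [multinom (if (b j < 0)%R then `|b j|%N else 0%N) | j < n].

Lemma pos_neg_partE b j : b j = (pos_part b j)%:Z - (neg_part b j)%:Z.
Proof.
rewrite !mnmE; case: (ltrgt0P (b j)) => bj; rewrite ?subr0 ?sub0r.
- by rewrite gtz0_abs.
- by rewrite ltz0_abs // opprK.
- by rewrite bj.
Qed.

(** The monomial of [pos_part b] has coefficient 1 or 2 on the left, so it occurs on the right and
    can be cancelled; which of the two monomials it equals there decides the sign. *)
Lemma exchange_poly_inj b c :
  'X_[pos_part b] + 'X_[neg_part b] = 'X_[pos_part c] + 'X_[neg_part c] :> {mpoly rat[n]} ->
  exists e : bool, forall j, c j = (-1) ^+ e * b j.
Proof.
have Xinj m m' : 'X_[m] = 'X_[m'] :> {mpoly rat[n]} -> m = m'.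
  move/(congr1 (mcoeff m')); rewrite !mcoeffX eqxx.
  by case: eqP => // _ /eqP; rewrite eq_sym oner_eq0.
move=> eqbc; have : pos_part c == pos_part b \/ neg_part c == pos_part b.
  move/(congr1 (mcoeff (pos_part b))): eqbc; rewrite !mcoeffD !mcoeffX eqxx.
  case: (pos_part c == _); first by left.
  case: (neg_part c == _); first by right.
  by rewrite addr0 -[1 in LHS]/(1%:R) -natrD => /eqP; rewrite pnatr_eq0.
case=> /eqP posb.
  move: eqbc; rewrite posb => /addrI/Xinj negb; exists false => j.
  by rewrite mul1r (pos_neg_partE c) (pos_neg_partE b) posb negb.
move: eqbc; rewrite posb addrC => /addIr/Xinj negb; exists true => j.
by rewrite mulN1r (pos_neg_partE c) (pos_neg_partE b) posb negb opprB.
Qed.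

Variables (F : fieldType) (F0 : [pchar F] =i pred0).

Lemma pevalD (y : {ffun 'I_n -> F}) p q : peval y (p + q) = peval y p + peval y q.
Proof. by rewrite !(peval_rmorphE F0) rmorphD. Qed.

Lemma peval_exchange_poly (y : {ffun 'I_n -> F}) b :
  peval y ('X_[pos_part b] + 'X_[neg_part b]) = exchange_poly y b.
Proof.
rewrite pevalD !(pevalX F0) /exchange_poly; congr (_ + _); rewrite [RHS]big_mkcond;
  by apply: eq_bigr => j _; rewrite mnmE; case: ifP.
Qed.

End ExchangePolynomial.

(** * Cluster automorphisms and tree automorphisms *)

Section Automorphisms.
Variables (n : nat) (F : fieldType) (F0 : [pchar F] =i pred0).
Variables (T : labeled_tree n) (Sigma : cluster_pattern F T).
Implicit Types (t u : T) (k i j : 'I_n) (s : 'S_n) (e : bool).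

Local Notation A := (cluster_algebra Sigma).
Local Notation B t := (exchange_mx (Sigma t)).
Local Notation x t := (cluster (Sigma t)).
Local Notation cv t i := (cluster_var Sigma t i).

Lemma cluster_algebra_ind (P : A -> Prop) :
    P 1 -> (forall a b, P a -> P b -> P (a - b)) ->
    (forall a b, P a -> P b -> P (a * b)) -> (forall t i, P (cv t i)) ->
  forall a, P a.
Proof.
move=> P1 PB PM Pcv a.
pose Q : {pred F} := fun y => `[< exists2 b : A, val b = y & P b >].
have /asboolP[] : val a \in Q; last by move=> b /val_inj ->.
have /asboolP := cluster_algebra_valP a; apply.
  split=> [|y z /asboolP[b <- Pb] /asboolP[c <- Pc]|y z /asboolP[b <- Pb] /asboolP[c <- Pc]];
    apply/asboolP.
  - by exists 1.
  - by exists (b - c); rewrite ?rmorphB //; apply: PB.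
  - by exists (b * c); rewrite ?rmorphM //; apply: PM.
by move=> t i; apply/asboolP; exists (cv t i).
Qed.

Lemma cluster_free t : algebraically_free (x t).
Proof. by case: (seed_atP Sigma t) => -[]. Qed.

Lemma cluster_var_neq0 t i : cv t i != 0.
Proof. by rewrite -(inj_eq val_inj); apply: algebraically_free_neq0 (@cluster_free t). Qed.

Lemma exchange_mx_nbr k t : B (nbr k t) = mx_mutation k (B t).
Proof. by rewrite seed_at_nbr; case: (seed_at Sigma t). Qed.

Lemma cluster_var_nbr k t i : i != k -> cv (nbr k t) i = cv t i.
Proof.
move=> ik; apply: val_inj; rewrite /= seed_at_nbr.
by case: (seed_at Sigma t) => y C /=; rewrite ffunE (negPf ik).
Qed.

Lemma cluster_exchange k t :
  x (nbr k t) k * x t k = exchange_poly (x t) (fun j => B t j k).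
Proof.
have := algebraically_free_neq0 F0 k (@cluster_free t); rewrite seed_at_nbr.
by case: (seed_at Sigma t) => y C /= y0; rewrite ffunE eqxx divfK.
Qed.

Lemma cluster_var_exchange k t :
  cv (nbr k t) k * cv t k = exchange_poly (fun j => cv t j) (fun j => B t j k).
Proof.
apply: val_inj; rewrite (rmorph_exchange_poly val) rmorphM.
exact: cluster_exchange.
Qed.

(** Injectivity keeps the image of x_k nonzero, so the exchange relation determines the image of the
    mutated variable; agreement spreads along the tree. *)
Lemma hom_ext (g h : {rmorphism A -> F}) t : injective g ->
  (forall i, g (cv t i) = h (cv t i)) -> g =1 h.
Proof.
move=> ginj ght.
suff gh u i : g (cv u i) = h (cv u i).
  apply: cluster_algebra_ind => //; first by rewrite !rmorph1.
  - by move=> a b; rewrite !rmorphB => -> ->.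
  - by move=> a b; rewrite !rmorphM => -> ->.
move: u i; apply: (tree_ind ght) => k u ghu i.
have [->|ik] := eqVneq i k; last by rewrite cluster_var_nbr.
have gk0 : g (cv u k) != 0.
  by rewrite -(rmorph0 g) (inj_eq ginj) cluster_var_neq0.
apply: (mulIf gk0); rewrite {2}ghu -!rmorphM cluster_var_exchange.
by rewrite !rmorph_exchange_poly; congr exchange_poly; apply/funext => j /=.
Qed.

Lemma hom_nbr (g : {rmorphism A -> F}) s e t u k : mx_match s e (B t) (B u) ->
    (forall i, g (cv t i) = x u (s i)) ->
  forall i, g (cv (nbr k t) i) = x (nbr (s k) u) (s i).
Proof.
move=> tu gt i; have [->|ik] := eqVneq i k; last first.
  rewrite cluster_var_nbr // gt; apply/esym.
  have sik : s i != s k by rewrite (inj_eq perm_inj).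
  exact: (congr1 val (cluster_var_nbr u sik)).
have xk0 := algebraically_free_neq0 F0 (s k) (@cluster_free u).
apply: (mulIf xk0); rewrite cluster_exchange -gt -rmorphM cluster_var_exchange.
rewrite rmorph_exchange_poly -[RHS](exchange_poly_perm _ _ s).
have -> : g \o (fun j => cv t j) = x u \o s by apply/funext => j /=.
by apply: esym; exact: exchange_poly_sign (tu ^~ k).
Qed.

Lemma maps_clusterP f s t u :
  maps_cluster f s t u <-> forall i, f (cv t i) = cv u (s i).
Proof.
by split=> fs i; [rewrite -fs permK | rewrite fs permKV].
Qed.

(* [f] is the automorphism (Sigma_t, Sigma_(tau t), s, e) for every [t]. *)
Definition aut_data (f : A -> A) (tau : T -> T) s e : Prop :=
  [/\ ring_aut f, tree_equivariant s tau,
      forall t i, f (cv t i) = cv (tau t) (s i)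
    & forall t, mx_match s e (B t) (B (tau t))].

Lemma ring_autP (f : A -> A) : ring_aut f ->
  exists2 g : {rmorphism A -> A}, f = g & injective g.
Proof.
case=> fZ fM /bij_inj finj.
by exists (HB.pack_for {rmorphism A -> A} f
  (GRing.isZmodMorphism.Build _ _ _ fZ) (GRing.isMonoidMorphism.Build _ _ _ fM)).
Qed.

Lemma hom_transport (g : {rmorphism A -> F}) tau s e t :
    tree_equivariant s tau -> mx_match s e (B t) (B (tau t)) ->
    (forall i, g (cv t i) = x (tau t) (s i)) ->
  forall u, mx_match s e (B u) (B (tau u)) /\
            (forall i, g (cv u i) = x (tau u) (s i)).
Proof.
move=> etau tt gt; apply: (@tree_ind _ _ _ t) => // k u [uu gu].
rewrite etau; split; last exact: hom_nbr gu.
by rewrite !exchange_mx_nbr; apply: mx_match_mutation.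
Qed.

Lemma aut_data_transport f s e t u : ring_aut f -> mx_match s e (B t) (B u) ->
    (forall i, f (cv t i) = cv u (s i)) ->
  exists2 tau, aut_data f tau s e & tau t = u.
Proof.
move=> fA; have [g fg ginj] := ring_autP fA; rewrite fg in fA *.
move=> tu gtu; have [tau etau taut] := tree_equivariant_ex s t u.
exists tau => //; rewrite -taut in tu gtu.
have gt := @hom_transport (val \o g) _ _ _ _ etau tu _.
have {}gt u' := gt (fun i => congr1 val (gtu i)) u'.
split=> // [t' i|t']; last by case: (gt t').
by apply: val_inj; case: (gt t') => _; apply.
Qed.

(** The substitution morphism of [F] sends cluster variables to cluster variables by
    [hom_transport], hence restricts to the cluster algebra; a field morphism is injective. *)
Lemma cluster_hom_ex s e t u : mx_match s e (B t) (B u) ->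
  exists2 g : {rmorphism A -> A}, injective g & forall i, g (cv t i) = cv u (s i).
Proof.
move=> tu.
have [phi phit] := free_generators_hom F0 (seed_atP Sigma t).1
  (algebraically_free_perm F0 (s := s) (@cluster_free u)).
have [tau etau taut] := tree_equivariant_ex s t u; rewrite -taut in tu *.
have phiA (a : A) : phi (val a) \in in_cluster_algebra Sigma.
  elim/cluster_algebra_ind: a => [|a b|a b|t' i].
  - by rewrite !rmorph1 rpred1.
  - by rewrite !rmorphB; apply: rpredB.
  - by rewrite !rmorphM; apply: rpredM.
  have phit' j : (phi \o val) (cv t j) = x (tau t) (s j) by rewrite /= phit ffunE taut.
  have [_ /(_ i)] := hom_transport etau tu phit' t'.
  by move=> /= ->; apply: cluster_var_subproof.
pose g (a : A) : A := ClusterAlgebra (phiA a).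
have gZ : zmod_morphism g by move=> a b; apply: val_inj; rewrite /= !rmorphB.
have gM : monoid_morphism g.
  by split=> [|a b]; apply: val_inj; rewrite /= (rmorph1, rmorphM) ?rmorph1 ?rmorphM.
exists (HB.pack_for {rmorphism A -> A} g
  (GRing.isZmodMorphism.Build _ _ _ gZ) (GRing.isMonoidMorphism.Build _ _ _ gM)).
  by move=> a b /(congr1 val) /= /fmorph_inj /val_inj.
by move=> i; apply: val_inj; rewrite /= phit ffunE taut.
Qed.

(** The match and its inverse give two injective endomorphisms whose composites fix a cluster, hence
    are the identity by [hom_ext]. *)
Lemma aut_data_ex s e t u : mx_match s e (B t) (B u) ->
  exists f tau, aut_data f tau s e /\ tau t = u.
Proof.
move=> tu; have [g ginj gt] := cluster_hom_ex tu.
have [h hinj hu] := cluster_hom_ex (mx_match_inv tu).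
suff gA : ring_aut g.
  by have [tau ? ?] := aut_data_transport gA tu gt; exists g, tau.
split; [exact: rmorphB | exact: (rmorph1 g, rmorphM g) |].
exists h => a; apply: val_inj.
  apply: (@hom_ext (val \o (h \o g)) val t) => [|i /=].
    exact/inj_comp/inj_comp/ginj/hinj/val_inj.
  by rewrite gt hu permK.
apply: (@hom_ext (val \o (g \o h)) val u) => [|i /=].
  exact/inj_comp/inj_comp/hinj/ginj/val_inj.
by rewrite hu gt permKV.
Qed.

Lemma aut_data_id : aut_data id id 1%g false.
Proof.
split=> [|k t|t i|t]; rewrite ?perm1 //; last exact: mx_match_id.
by split=> //; exists id.
Qed.

Lemma aut_data_comp f g tau tau' s s' e e' :
    aut_data f tau s e -> aut_data g tau' s' e' ->
  aut_data (f \o g) (tau \o tau') (s' * s)%g (e (+) e').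
Proof.
move=> [[fZ fM fb] etau ft ttau] [[gZ gM gb] etau' gt ttau'].
split=> [|k t|t i|t] /=.
- split; last exact: bij_comp.
    by move=> a b; rewrite /= gZ fZ.
  by case: fM gM => f1 fM [g1 gM]; split=> [|a b] /=; rewrite ?g1 ?gM.
- by rewrite permM etau' etau.
- by rewrite permM gt ft.
- exact: mx_match_comp.
Qed.

Lemma aut_data_inv f g tau s e : aut_data f tau s e -> cancel f g -> cancel g f ->
  exists tau', [/\ aut_data g tau' s^-1%g e, cancel tau tau' & cancel tau' tau].
Proof.
move=> [fA etau ft ttau] fK gK; have [h fh hinj] := ring_autP fA; subst f.
have [tau' [etau' tauK tauK']] := tree_equivariant_inv etau.
exists tau'; split=> //; split=> // [|t i|t].
- split; [|split|by exists h]; [move=> a b| |move=> a b]; apply: hinj;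
    by rewrite ?rmorphB ?rmorphM ?rmorph1 !gK.
- by apply: hinj; rewrite gK ft tauK' permKV.
- by have /mx_match_inv := ttau (tau' t); rewrite tauK'.
Qed.

Lemma aut_match f s t u : indecomposable (B t) -> ring_aut f ->
    (forall i, f (cv t i) = cv u (s i)) ->
    (forall k i, f (cv (nbr k t) i) = cv (nbr (s k) u) (s i)) ->
  exists e, mx_match s e (B t) (B u).
Proof.
move=> indB fA; have [g -> ginj] := ring_autP fA; move=> gt gnbr.
(* Apply [f] to the exchange relation at [k]: by freeness of the target cluster the two exchange
   polynomials coincide, which gives a sign for each column. *)
have column k : exists e : bool, forall j, B u (s j) (s k) = (-1) ^+ e * B t j k.
  apply: exchange_poly_inj; apply/eqP; rewrite -subr_eq0; apply/eqP.
  apply: (algebraically_free_perm F0 (s := s) (@cluster_free u)).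
  rewrite (peval_rmorphE F0) rmorphB -!peval_rmorphE !(peval_exchange_poly F0).
  apply/eqP; rewrite subr_eq0; apply/eqP.
  have := congr1 (val \o g) (cluster_var_exchange k t).
  rewrite rmorphM rmorph_exchange_poly /= gt gnbr [X in X = _]cluster_exchange.
  rewrite -[X in X = _](exchange_poly_perm _ _ s).
  set y := _ \o _; set z := _ \o _ => yz.
  have -> : [ffun i => x u (s i)] = y :> (_ -> _) by apply/funext => j; rewrite ffunE.
  rewrite yz; congr exchange_poly; apply/funext => j.
  by rewrite /z /= gt.
have [sgn sgnP] := choice column.
(* Both b_ij b_ji and its image are negative, and they differ by the product of the two column
   signs. *)
have sgn_adj i j : (B t i j != 0) || (B t j i != 0) -> sgn i = sgn j.
  wlog: i j / B t i j != 0.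
    by move=> wl /orP[ij|ji]; [apply: wl | apply/esym/wl] => //; rewrite ?ij ?ji.
  move=> ij _; have skew := seed_atP Sigma.
  have tij := skew_symmetrizable_mul_lt0 (skew t).2 ij.
  have uij : B u (s i) (s j) * B u (s j) (s i) < 0.
    apply: skew_symmetrizable_mul_lt0 (skew u).2 _.
    by rewrite sgnP mulf_neq0 ?signr_eq0.
  move: uij; rewrite !sgnP mulrACA -signr_addb.
  case: (sgn i) (sgn j) => -[] //=; rewrite mulN1r oppr_lt0 => /(lt_trans tij);
    by rewrite ltxx.
have sgn_const i j : sgn i = sgn j.
  have /connectP[p ip ->] := indB i j.
  elim: p i ip => //= k p IHp i /andP[/sgn_adj -> kp]; exact: IHp.
(* In rank 0 there is no column to read the sign from, and any sign will do. *)
have [i0|no] := pselect (exists i : 'I_n, True); last first.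
  by exists false => i; case: no; exists i.
case: i0 => i0 _; exists (sgn i0) => i j.
by rewrite sgnP (sgn_const i0 j).
Qed.

Lemma cluster_autP t0 f : indecomposable (B t0) ->
  cluster_aut Sigma t0 f <-> exists tau s e, aut_data f tau s e.
Proof.
move=> indB; split=> [[fA [u [s [/maps_clusterP ft fnbr]]]]|[tau [s [e [fA etau ft _]]]]].
  have [|e tu] := aut_match indB fA ft; first by move=> k; apply/maps_clusterP.
  by have [tau ftau _] := aut_data_transport fA tu ft; exists tau, s, e.
split=> //; exists (tau t0), s; split; first exact/maps_clusterP.
by move=> k; apply/maps_clusterP => i; rewrite ft etau.
Qed.

End Automorphisms.

(** * Weights of paths *)

Lemma count_gt2_split (X : Type) (a : pred X) s : (2 < count a s)%N ->
  exists p1 u p2, [/\ s = p1 ++ u :: p2, a u, has a p1 & has a p2].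
Proof.
have split_has q : has a q ->
    exists u p1 p2, [/\ q = p1 ++ u :: p2, a u & count a q = (count a p2).+1].
  case/split_find=> u p1 p2 au; rewrite has_count -leqNgt leqn0 => /eqP a1.
  by exists u, p1, p2; rewrite cat_rcons count_cat /= a1 au.
move=> as2; have [|u1 [p1 [q [sE au1 asE]]]] := split_has s.
  by rewrite has_count; lia.
have [|u [p [p2 [qE au aqE]]]] := split_has q; first by rewrite has_count; lia.
exists (rcons p1 u1 ++ p), u, p2; split=> //; last by rewrite has_count; lia.
  by rewrite sE qE -catA cat_rcons.
by rewrite has_cat has_rcons au1.
Qed.

Section Weights.
Variables (n : nat) (F : fieldType) (T : labeled_tree n).
Variable Sigma : cluster_pattern F T.
Implicit Types (t u v z : T).

Local Notation W := (weight Sigma).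

Definition sim u z := mx_sim_pm (exchange_mx (Sigma u)) (exchange_mx (Sigma z)).

Lemma weight_sym z t u : W z t u = W z u t.
Proof. by rewrite /weight tree_path_sym count_rev. Qed.

Lemma weight_refl z t : W z t t = sim t z.
Proof. by rewrite /weight tree_path_refl /= addn0. Qed.

Lemma weight_subadd z t u v : (W z t v + sim u z <= W z t u + W z u v)%N.
Proof. exact: tree_path_subadd. Qed.

Lemma weight_cat z t u v : u \in tree_path t v ->
  (W z t v + sim u z = W z t u + W z u v)%N.
Proof. exact: tree_path_count_cat. Qed.

Lemma weight_head z t u : (sim t z <= W z t u)%N.
Proof. by have [p tp _] := tree_pathP t u; rewrite /weight tp leq_addr. Qed.

Lemma weight_last z t u : (sim u z <= W z t u)%N.
Proof. by rewrite weight_sym weight_head. Qed.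

Lemma weight_ends z t u : t != u -> (sim t z + sim u z <= W z t u)%N.
Proof.
have [[|v p] tp [_ lp _]] := tree_pathP t u; first by rewrite -lp eqxx.
move=> _; rewrite /weight tp -cat1s (lastI v p) -cats1 !count_cat -[last v p]/(last t (v :: p)) lp.
by rewrite /= !addn0 leq_add2l leq_addl.
Qed.

(** With an occurrence on each side of u, both halves lose weight although each of them counts u. *)
Lemma weight_middle z t v : (2 < W z t v)%N -> exists u,
  [/\ u \in tree_path t v, sim u z, W z t u < W z t v & W z u v < W z t v]%N.
Proof.
pose a u := mx_sim_pm (exchange_mx (Sigma u)) (exchange_mx (Sigma z)); rewrite /weight -/a => wtv.
have [p1 [u [p2 [tvE au]]]] := count_gt2_split wtv; rewrite !has_count => a1 a2.
have [tu uv] := tree_path_split tvE.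
exists u; split=> //; first by rewrite tvE mem_cat inE eqxx orbT.
  by rewrite tu tvE -cats1 !count_cat /= au; lia.
by rewrite uv tvE count_cat; lia.
Qed.

Lemma aut_data_weight f tau s e z t u : aut_data (Sigma := Sigma) f tau s e ->
  W z (tau t) (tau u) = W z t u.
Proof.
move=> [_ etau _ ttau]; rewrite /weight (tree_equivariant_path _ _ etau) count_map.
apply: eq_count => v /=; apply/esym/mx_sim_pm_left/mx_sim_pmP.
by exists s, e.
Qed.

Lemma aut_data_sim f tau s e t : aut_data (Sigma := Sigma) f tau s e -> sim (tau t) t.
Proof.
by move=> [_ _ _ ttau]; rewrite /sim mx_sim_pm_sym; apply/mx_sim_pmP; exists s, e.
Qed.

Lemma sim_refl t : sim t t. Proof. exact: mx_sim_pm_refl. Qed.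

Lemma sim_left t u z : sim t u -> sim t z = sim u z.
Proof. exact: mx_sim_pm_left. Qed.

Lemma aut_data_sim_ex (F0 : [pchar F] =i pred0) t u : sim u t ->
  exists f tau s e, aut_data (Sigma := Sigma) f tau s e /\ tau t = u.
Proof.
rewrite /sim mx_sim_pm_sym => /mx_sim_pmP[s [e tu]].
by have [f [tau]] := aut_data_ex F0 tu; exists f, tau, s, e.
Qed.

End Weights.

(** * Generation by splitting paths *)

Section Generation.
Variables (n : nat) (F : fieldType) (F0 : [pchar F] =i pred0).
Variables (T : labeled_tree n) (Sigma : cluster_pattern F T).
Local Notation A := (cluster_algebra Sigma).
Local Notation W := (weight Sigma).
Local Notation sim := (sim Sigma).
Variables (t0 : T) (H : (A -> A) -> Prop).
Hypothesis H_comp : forall f g, H f -> H g -> H (f \o g).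

(** All automorphisms sending [t0] to [t], whereas [hit] asks for one: H1 offers a single chosen
    automorphism per endpoint, and the stabilizer of [t0] fills the gap. *)
Definition reached t := forall f tau s e,
  aut_data (Sigma := Sigma) f tau s e -> tau t0 = t -> H f.

Definition hit v := exists f tau s e,
  [/\ aut_data (Sigma := Sigma) f tau s e, tau t0 = v & H f].

Lemma reached_hit v : sim v t0 -> reached v -> hit v.
Proof.
move=> /(aut_data_sim_ex F0)[f [tau [s [e [fD tauv]]]]] Rv.
by exists f, tau, s, e; split=> //; exact: Rv fD tauv.
Qed.

(* If [f1] is the automorphism sending [t0] to [v], then [f1^-1 f] sends [t0] *)
(* to a vertex [t'] for which p(t0, t') is a copy of p(v, t).                 *)
Lemma reached_split v t : hit v ->
    (forall t', sim t' t0 -> (forall z, W z t0 t' = W z v t) -> reached t') ->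
  reached t.
Proof.
move=> [f1 [tau1 [s1 [e1 [f1D tau1v Hf1]]]]] Rt f tau s e fD taut.
have [[_ _ [g1 f1K g1K]] _ _ _] := f1D.
have [tau1' [g1D tauK _]] := aut_data_inv f1D f1K g1K.
have -> : f = f1 \o (g1 \o f) by apply/funext => a /=; rewrite g1K.
have gfD := aut_data_comp g1D fD.
apply: (H_comp Hf1); apply: (Rt (tau1' t) _ _ _ _ _ _ gfD); last by rewrite /= taut.
  by rewrite -taut; apply: aut_data_sim gfD.
by move=> z; rewrite -{1}(tauK t0) tau1v (aut_data_weight _ _ _ g1D).
Qed.

Hypothesis H_G0 : forall f tau s e, aut_data (Sigma := Sigma) f tau s e ->
  tau t0 = t0 -> H f.

Lemma reached_root : reached t0. Proof. exact: H_G0. Qed.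

Variables (r : nat) (mark : 'I_r -> T).
Hypothesis mark_neq_root : forall i, ~~ sim (mark i) t0.
Hypothesis mark_weight : forall i, W (mark i) t0 (mark i) = 1%N.
Hypothesis root_weight : forall i, W t0 t0 (mark i) = 1%N.
Hypothesis mark_weight0 : forall i j : 'I_r, (i < j)%N -> W (mark i) t0 (mark j) = 0%N.
Hypothesis H_P1 : forall t, sim t t0 -> W t0 t0 t = 2%N ->
  (forall i, W (mark i) t0 t <= 2)%N -> hit t.

(** Here [m] counts the last marks, whose weights are not yet bounded; the first of them, j = r -
    m.+1 in the step, is treated by an inner induction on its weight. *)
Lemma reached_two_marked m t : sim t t0 -> (W t0 t0 t <= 2)%N ->
  (forall i : 'I_r, i < r - m -> W (mark i) t0 t <= 2)%N -> reached t.
Proof.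
elim: m t => [|m IHm] t simt wt wmark.
  have [->|] := eqVneq t t0; first exact: reached_root.
  rewrite eq_sym => /(weight_ends Sigma t0); rewrite sim_refl simt => wt'.
  (* Splitting at the endpoint leaves a path of weight 1 for [t0], which must be trivial. *)
  apply: (@reached_split t) => [|t' simt' wtt].
    by apply: (H_P1 simt) => [|i]; [lia | by apply: wmark; rewrite subn0].
  have [->|] := eqVneq t' t0; first exact: reached_root.
  rewrite eq_sym => /(weight_ends Sigma t0).
  by rewrite wtt weight_refl sim_refl simt simt'.
have [rm|mr] := leqP r m.
  by apply: (IHm _ simt wt) => i im; exfalso; lia.
have jr : (r - m.+1 < r)%N by lia.
pose j := Ordinal jr; pose zj := mark j.
have [N] := ubnP (W zj t0 t).
elim: N t simt wt wmark => [|N IHN] t simt wt wmark wN; first by rewrite ltn0 in wN.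
have [wj|wj] := leqP (W zj t0 t) 2.
  apply: (IHm _ simt wt) => i; have [/val_inj -> //|ij im] := eqVneq (i : nat) j.
  by apply: wmark; move: ij; rewrite /=; lia.
have [u [utv uj wtu wut]] := weight_middle wj.
have [g [tau [s [e [gD gu]]]]] := aut_data_sim_ex F0 uj.
set v := tau t0.
have v0 : sim v t0 by apply: aut_data_sim gD.
have uvE z : W z u v = W z t0 zj by rewrite -gu (aut_data_weight _ _ _ gD) weight_sym.
have u0 : sim u t0 = false by rewrite (sim_left _ uj) (negPf (mark_neq_root _)).
have cat z := weight_cat Sigma z utv.
have sub1 z := weight_subadd Sigma z t0 u v.
have sub2 z := weight_subadd Sigma z v u t.
have end1 z := weight_last Sigma z t0 u.
have end2 z := weight_head Sigma z u t.
have small z : W z t0 zj = 0%N -> (W z t0 t <= 2)%N -> (W z t0 v <= 2 /\ W z v t <= 2)%N.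
  move=> z0; have := cat z; have := sub1 z; have := sub2 z; have := end1 z; have := end2 z.
  by rewrite (weight_sym _ z v u) uvE z0; lia.
(* Each half of p(t0, t) at u contains one vertex of the class of [t0], an end; by (ii) the copy of
   p(t_j, t0) adds at most one. *)
have [v2 vt2] : (W t0 t0 v <= 2 /\ W t0 v t <= 2)%N.
  have := cat t0; have := sub1 t0; have := sub2 t0.
  have := weight_head Sigma t0 t0 u; have := weight_last Sigma t0 u t.
  by rewrite (weight_sym _ t0 v u) uvE root_weight u0 sim_refl simt; lia.
(* By (ii) the copy meets the class of t_j only at u, and subadditivity discounts u. *)
have [vN vtN] : (W zj t0 v < N /\ W zj v t < N)%N.
  have := sub1 zj; have := sub2 zj.
  by rewrite (weight_sym _ zj v u) uvE mark_weight uj; lia.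
have vmark (i : 'I_r) : (i < r - m.+1 -> W (mark i) t0 v <= 2 /\ W (mark i) v t <= 2)%N.
  by move=> ij; apply: small; [apply: mark_weight0 | apply: wmark].
apply: (@reached_split v) => [|t' simt' wt'].
  by apply: (reached_hit v0); apply: (IHN _ v0 v2 _ vN) => i /vmark[].
by apply: (IHN _ simt') => [|i /vmark[_]|]; rewrite wt'.
Qed.

Lemma reached_all t : sim t t0 -> reached t.
Proof.
have [N] := ubnP (W t0 t0 t); elim: N t => [|N IHN] t wN simt; first by rewrite ltn0 in wN.
have [wt|wt] := leqP (W t0 t0 t) 2.
  (* With m = r no mark is assumed bounded. *)
  by apply: (@reached_two_marked r _ simt wt) => i im; exfalso; lia.
have [v [_ v0 w1 w2]] := weight_middle wt.
apply: (@reached_split v) => [|t' simt' wt'].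
  by apply: (reached_hit v0); apply: IHN v0; lia.
by apply: IHN simt'; rewrite wt'; lia.
Qed.

End Generation.

(** * The automorphism group and the generating set *)

Section SubgroupOfAutomorphisms.
Variables (n : nat) (F : fieldType) (F0 : [pchar F] =i pred0).
Variables (T : labeled_tree n) (Sigma : cluster_pattern F T).

Lemma cluster_aut_subgroup t0 : indecomposable (exchange_mx (Sigma t0)) ->
  is_subgroup (cluster_aut Sigma t0).
Proof.
move=> indB; split=> [f []//||f g|f g].
- by apply/(cluster_autP F0) => //; exists id, 1%g, false; exact: aut_data_id.
- move=> /(cluster_autP F0 _ indB)[tau [s [e fD]]] /(cluster_autP F0 _ indB)[tau' [s' [e' gD]]].
  apply/(cluster_autP F0 _ indB); exists (tau \o tau'), (s' * s)%g, (e (+) e').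
  exact: aut_data_comp.
- move=> /(cluster_autP F0 _ indB)[tau [s [e fD]]] fK gK.
  have [tau' [gD _ _]] := aut_data_inv fD fK gK.
  by apply/(cluster_autP F0 _ indB); exists tau', (s^-1)%g, e.
Qed.

Lemma aut_data_is_aut_of t0 f tau s e t : indecomposable (exchange_mx (Sigma t0)) ->
  aut_data (Sigma := Sigma) f tau s e -> is_aut_of t0 t (tau t) s e f.
Proof.
move=> indB fD; split; first by apply/mx_matchP; case: fD.
  by apply/(cluster_autP F0 _ indB); exists tau, s, e.
by apply/maps_clusterP; case: fD.
Qed.

End SubgroupOfAutomorphisms.

Local Open Scope classical_set_scope.

Theorem theorem3p3 (n : nat) (F : fieldType) (hF : purely_transcendental n F)
  (T : labeled_tree n) (Sigma : cluster_pattern F T)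
  (hind : forall t : T, indecomposable (exchange_mx (Sigma t)))
  (t0 : T) (sg : T -> 'S_n) (ep : T -> bool)
  (hfix : forall t : T, P1 Sigma t0 t -> matches Sigma t0 t (sg t) (ep t))
  (r : nat) (hr : (0 < r)%N) (mark : 'I_r -> T)
  (hi : forall i j : 'I_r.+1, i != j ->
     ~~ mx_sim_pm (exchange_mx (Sigma (with_root t0 mark i)))
                  (exchange_mx (Sigma (with_root t0 mark j))))
  (hii : forall i : 'I_r.+1,
     weight Sigma (with_root t0 mark i) t0 (with_root t0 mark i) = 1%N /\
     weight Sigma t0 t0 (with_root t0 mark i) = 1%N)
  (hiii : forall i j : 'I_r, (i < j)%N ->
     weight Sigma (mark i) t0 (mark j) = 0%N) :
  generated_subgroup
    (G0 Sigma t0 `|`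
     \bigcup_(i : {ffun 'I_r -> 'I_3})
       H1 Sigma t0 sg ep mark (fun k => nat_of_ord (i k)))
  = cluster_aut Sigma t0.
Proof.
have [F0 _] := hF; have indB := hind t0.
have rootE : with_root t0 mark ord0 = t0 by rewrite /with_root unlift_none.
have markE i : with_root t0 mark (lift ord0 i) = mark i by rewrite /with_root liftK.
apply/seteqP; split.
  apply: smallest_sub; first exact: cluster_aut_subgroup.
  by move=> f [[u [s [e [_ []]]]]|[i _ [u _ []]]].
move=> f /(cluster_autP F0 _ indB)[tau [s [e fD]]] H [[_ _ Hcomp _] HX].
(* [H] is an arbitrary subgroup containing the generators; membership of [f] in all of them is the
   claim. *)
apply: (reached_all (mark := mark) F0 Hcomp _ _ _ _ _ _ (aut_data_sim t0 fD) fD erefl).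
- move=> g tau' s' e' gD tau0; apply: HX; left; exists t0, s', e'; split.
    by rewrite weight_refl sim_refl.
  by have := aut_data_is_aut_of F0 t0 indB gD; rewrite tau0.
- by move=> i; rewrite -rootE -markE; apply: hi.
- by move=> i; rewrite -markE; case: (hii (lift ord0 i)).
- by move=> i; rewrite -markE; case: (hii (lift ord0 i)).
- exact: hiii.
move=> t simt wt wmark; have tP1 : P1 Sigma t0 t by split.
have [g [tau' [gD gt]]] := aut_data_ex F0 ((mx_matchP _ _ _ _).1 (hfix _ tP1)).
exists g, tau', (sg t), (ep t); split=> //; apply: HX; right.
(* The marked weights are at most 2, so [inord] into ['I_3] keeps their values. *)
exists [ffun k => inord (weight Sigma (mark k) t0 t)] => //; exists t.
  by split=> [|k]; [exact: tP1 | rewrite ffunE inordK // ltnS wmark].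
by have := aut_data_is_aut_of F0 t0 indB gD; rewrite gt.
Qed.
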